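(* Let $\lambda$ be a frequency and $k\in\mathbb N$. If $\mathcal B=\{e^{-\lambda_n s}\}$ is democratic for $\mathcal H_{2k}^\lambda$, then $$\Big\|\sum_{n\in A}a_n e^{-\lambda_n s}\Big\|_{\mathcal H_2^\lambda}\le\Big\|\sum_{n\in A}a_n e^{-\lambda_n s}\Big\|_{\mathcal H_{2k}^\lambda}\lesssim\log(|A|+1)\,\Big\|\sum_{n\in A}a_n e^{-\lambda_n s}\Big\|_{\mathcal H_2^\lambda}$$ for all finite sets $A\subset\mathbb N$ and all scalars $(a_n)\subset\mathbb C$.
   Context: A frequency is a strictly increasing unbounded sequence $\lambda=(\lambda_n)_{n\ge1}$ of non-negative real numbers. For $1\le p<\infty$, a $\lambda$-Dirichlet polynomial $D=\sum_{n\in A}a_n e^{-\lambda_n s}$ ($A\subset\mathbb N$ finite, $a_n\in\mathbb C$) has norm $\|D\|_{\mathcal H_p^\lambda}=\lim_{R\to\infty}\big(\frac1{2R}\int_{-R}^R|\sum_{n\in A}a_n e^{-\lambda_n it}|^p\,dt\big)^{1/p}$, and $\mathcal H_p^\lambda$ is the completion of the space of $\lambda$-Dirichlet polynomials under this norm. $\mathcal B$ is democratic for $\mathcal H_p^\lambda$ if there is $C>0$ such that $\|\sum_{n\in A}e^{-\lambda_n s}\|_{\mathcal H_p^\lambda}\le C\|\sum_{n\in B}e^{-\lambda_n s}\|_{\mathcal H_p^\lambda}$ for all finite sets $A,B\subset\mathbb N$ with $|A|\le|B|$. The symbol $\lesssim$ means that the inequality holds up to a multiplicative constant independent of $A$ and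 of $(a_n)$. *)

(* Defs.v *)
From HB Require Import structures.
From mathcomp Require Import all_boot all_order all_algebra.
From mathcomp Require Import finmap.
From mathcomp Require Import all_classical all_reals all_analysis.
From mathcomp.real_closed Require Import complex.

Set Implicit Arguments.
Unset Strict Implicit.
Unset Printing Implicit Defensive.

Import Order.TTheory GRing.Theory Num.Theory.
Import numFieldNormedType.Exports.

Local Open Scope classical_set_scope.
Local Open Scope ring_scope.
Local Open Scope complex_scope.

(* Sequences are indexed from 0: [lambda n] is the (n+1)-st frequency. *)
Definition frequency (R : realType) (lambda : nat -> R) : Prop :=
  [/\ forall n, 0 <= lambda n,
      forall m n, (m < n)%N -> lambda m < lambda n
    & ~ has_ubound (range lambda)].

Definition cexp (R : realType) (z : R[i]) : R[i] :=
  (expR (complex.Re z))%:C * (cos (complex.Im z) +i* sin (complex.Im z)).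

Definition dirichlet_poly (R : realType) (lambda : nat -> R)
    (A : {fset nat}) (a : nat -> R[i]) (s : R[i]) : R[i] :=
  \sum_(n <- A) a n * cexp (- (lambda n)%:C * s).

(* Only used on Dirichlet polynomials, for which the limit exists. *)
Definition Hnorm (R : realType) (p : R) (D : R[i] -> R[i]) : R :=
  lim (((2 * T)^-1 *
        \int[lebesgue_measure]_(t in `[- T, T])
          (ComplexField.Normc.normc (D (0 +i* t)) `^ p)) `^ p^-1
       @[T --> +oo]).

Definition democratic (R : realType) (lambda : nat -> R) (p : R) : Prop :=
  exists2 C : R, 0 < C &
    forall A B : {fset nat}, (#|` A| <= #|` B|)%N ->
      Hnorm p (dirichlet_poly lambda A (fun=> 1))
        <= C * Hnorm p (dirichlet_poly lambda B (fun=> 1)).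

(* Main.v *)
Require Import Defs.
From HB Require Import structures.
From mathcomp Require Import all_boot all_order all_algebra.
From mathcomp Require Import finmap.
From mathcomp Require Import all_classical all_reals all_analysis.
From mathcomp.real_closed Require Import complex.
From mathcomp Require Import perm ring lra.

Import Order.TTheory GRing.Theory Num.Theory.
Import numFieldNormedType.Exports.

Set Implicit Arguments.
Unset Strict Implicit.
Unset Printing Implicit Defensive.

Local Open Scope classical_set_scope.
Local Open Scope ring_scope.
Local Open Scope complex_scope.

(** The mean over the line of an exponential sum is the sum of its
coefficients at frequency zero.  Expanding the [k]-th power of
[D = sum_n a_n e^(-i lambda_n t)] over the [k]-tuples [f] of indices, the mean
of [|D|^(2k) = |D^k|^2] is therefore
[sum_(f, g) Re (a_f conj(a_g))], the sum being over the pairs of tuples with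
[sum_i lambda (f i) = sum_i lambda (g i)] ([has_mean_dirichlet]); call it the
moment of [D].  Being an exact limit, it inherits all pointwise inequalities,
so the first half of the theorem is Jensen's inequality [moment1_exp_le].  The
formula also shows that the moment only grows when each [a_n] is replaced by a
number [b_n >= |a_n|] ([le_moment]).

For the upper bound, democracy is compared with a lacunary set.  As [lambda] is
unbounded, there are index sets [B] of any size in which each frequency exceeds
[k] times the previous one.  A sum of [k] frequencies from [B] then determines
the summands up to order, so at most [k! |B|^k] pairs of tuples contribute to
the moment of [sum_(n in B) e^(-i lambda_n t)] ([moment_lacunary]).  Democracy
transfers the bound to every set: the norm of [sum_(n in A) e^(-i lambda_n t)]
in [H_2k] is at most a constant times [sqrt |A|] ([democratic_moment]).

For general coefficients let [sigma] be the norm of [D] in [H_2].  The set of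
[n] with [|a_n| > sigma / 2^(j+1)] has at most [4^(j+1)] elements, and
[|a_n|] is bounded by the sum of [sigma / 2^j] over the levels [j] to which [n]
belongs.  By monotonicity and the triangle inequality the norm of [D] in [H_2k]
is at most the sum over the levels of
[(sigma / 2^j) sqrt (4^(j+1)) = 2 sigma], up to a constant; beyond
[m = O(log (|A| + 1))] levels all remaining coefficients can be put in a single
level because [|A| <= 4^m] ([moment_le_levels]). *)

(** * Means of functions over the real line *)

Section Mean.
Variable R : realType.
Implicit Types (f g : R -> R) (l c mu T : R).

(** Continuity is included to make all the integrals finite, so that the mean
    is linear and monotone with no further side condition. *)
Definition has_mean f l : Prop :=
  continuous f /\
  (2 * T)^-1 * \int[lebesgue_measure]_(t in `[- T, T]) f t @[T --> +oo] --> l.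

Lemma continuous_integrable_itv f T : continuous f ->
  lebesgue_measure.-integrable `[- T, T] (EFin \o f).
Proof.
move=> cf; apply: continuous_compact_integrable; first exact: segment_compact.
by apply: continuous_subspaceT.
Qed.

Lemma has_mean_cst c : has_mean (fun=> c) c.
Proof.
split; first by move=> x; apply: cvg_cst.
apply: cvg_near_cst; near=> T.
have T0 : 0 < T by near: T; exact: (nbhs_pinfty_gt (num_real 0)).
rewrite Rintegral_cst //= lebesgue_measure_itv /= lte_fin ifT; last lra.
rewrite -EFinB /= opprK.
by field; lra.
Unshelve. all: by end_near. Qed.

Lemma has_meanD f g l l' : has_mean f l -> has_mean g l' ->
  has_mean (fun t => f t + g t) (l + l').
Proof.
move=> [cf hf] [cg hg]; split.
  by move=> x; apply: (@cvgD _ _ _ _ _ f g); [exact: cf|exact: cg].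
apply: (cvg_trans _ (cvgD hf hg)); apply: near_eq_cvg; near=> T.
by rewrite RintegralD ?mulrDr //; exact: continuous_integrable_itv.
Unshelve. all: by end_near.
Qed.

Lemma has_meanZ f l c : has_mean f l -> has_mean (fun t => c * f t) (c * l).
Proof.
move=> [cf hf]; split.
  by move=> x; apply: (@cvgM _ _ _ _ (fun=> c) f); [exact: cvg_cst|exact: cf].
apply: (cvg_trans _ (cvgM (cvg_cst c) hf)); apply: near_eq_cvg; near=> T.
rewrite RintegralZl //=; first by rewrite mulrCA.
exact: continuous_integrable_itv.
Unshelve. all: by end_near.
Qed.

Lemma has_mean_sum (I : Type) (r : seq I) (F : I -> R -> R) (L : I -> R) :
  (forall i, has_mean (F i) (L i)) ->
  has_mean (fun t => \sum_(i <- r) F i t) (\sum_(i <- r) L i).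
Proof.
move=> h; elim: r => [|i r IH].
  rewrite big_nil; under eq_fun do rewrite big_nil; exact: has_mean_cst.
rewrite big_cons; under eq_fun do rewrite big_cons; exact: has_meanD.
Qed.

Lemma has_mean_le f g l l' : has_mean f l -> has_mean g l' ->
  (forall t, f t <= g t) -> l <= l'.
Proof.
move=> [cf hf] [cg hg] fg; apply: ler_cvg_to hf hg _; near=> T.
have T0 : 0 < T by near: T; exact: (nbhs_pinfty_gt (num_real 0)).
rewrite ler_wpM2l //; first by rewrite invr_ge0; lra.
by apply: le_Rintegral => //; exact: continuous_integrable_itv.
Unshelve. all: by end_near. Qed.

Lemma has_mean_unique f l l' : has_mean f l -> has_mean f l' -> l = l'.
Proof.
by move=> h h'; apply/eqP; rewrite eq_le !(has_mean_le h h', has_mean_le h' h).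
Qed.

(** The integral over [[-T, T]] is at most [2 c], so dividing it by [2 T] gives
    zero in the limit. *)
Lemma has_mean_bounded_primitive f (F : R -> R) c : continuous f ->
  (forall t : R, is_derive t 1 F (f t)) -> (forall t, `|F t| <= c) ->
  has_mean f 0.
Proof.
move=> cf dF bF; split=> //.
have cF : continuous F.
  move=> t; apply: differentiable_continuous; apply/derivable1_diffP.
  by case: (dF t).
have cvgc : (2 * T)^-1 * (2 * c) @[T --> +oo] --> (0 : R).
  have -> : (fun T => (2 * T)^-1 * (2 * c)) = (fun T => T^-1 * c).
    apply/funext => T; rewrite invfM [2^-1 * _]mulrC -mulrA.
    by rewrite mulKf ?pnatr_eq0.
  rewrite -[X in _ --> X](mul0r c); apply: cvgM; last exact: cvg_cst.
  apply/gtr0_cvgV0; last exact: cvg_id.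
  exact: (nbhs_pinfty_gt (num_real 0)).
have cvgN : - ((2 * T)^-1 * (2 * c)) @[T --> +oo] --> (0 : R).
  by rewrite -oppr0; apply: cvgN.
apply: (squeeze_cvgr _ cvgN cvgc); near=> T.
have T0 : 0 < T by near: T; exact: (nbhs_pinfty_gt (num_real 0)).
have -> : \int[lebesgue_measure]_(t in `[- T, T]) f t = F T - F (- T).
  rewrite /Rintegral (@continuous_FTC2 _ f F) //=.
  - by lra.
  - exact: continuous_subspaceT.
  - split; first by move=> x _; case: (dF x).
    + by apply: cvg_at_right_filter; exact: cF.
    + by apply: cvg_at_left_filter; exact: cF.
  - by move=> x _; rewrite derive1E; apply: derive_val.
have h : `|F T - F (- T)| <= 2 * c.
  rewrite (le_trans (ler_normB _ _)) // mulr_natl mulr2n; exact: lerD.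
rewrite -ler_norml normrM ger0_norm ?invr_ge0 ?ler_wpM2l ?invr_ge0 //; lra.
Unshelve. all: by end_near. Qed.

Lemma has_mean_cos mu : mu != 0 -> has_mean (fun t => cos (mu * t)) 0.
Proof.
move=> mu0; pose F t := mu^-1 * sin (mu * t).
apply: (@has_mean_bounded_primitive _ F `|mu^-1|).
- move=> x; apply: (@continuous_comp _ _ _ (fun t => mu * t) cos).
    by apply: (@cvgM _ _ _ _ (fun=> mu) id); [exact: cvg_cst|exact: cvg_id].
  exact: continuous_cos.
- move=> t; apply: is_derive_eq.
  by rewrite /GRing.scale /= !mulr1 ?mulr0 ?addr0 mulrCA mulVf // mulr1.
- by move=> t; rewrite normrM ler_piMr // ler_norml sin_geN1 sin_le1.
Qed.

Lemma has_mean_sin mu : has_mean (fun t => sin (mu * t)) 0.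
Proof.
have [->|mu0] := eqVneq mu 0.
  by under eq_fun do rewrite mul0r sin0; exact: has_mean_cst.
pose F t := - mu^-1 * cos (mu * t).
apply: (@has_mean_bounded_primitive _ F `|mu^-1|).
- move=> x; apply: (@continuous_comp _ _ _ (fun t => mu * t) sin).
    by apply: (@cvgM _ _ _ _ (fun=> mu) id); [exact: cvg_cst|exact: cvg_id].
  exact: continuous_sin.
- move=> t; apply: is_derive_eq.
  rewrite /GRing.scale /= !mulr1 ?mulr0 ?addr0 (mulNr (sin _)).
  by rewrite mulrNN mulrCA mulVf // mulr1.
- by move=> t; rewrite normrM normrN ler_piMr // ler_norml cos_geN1 cos_le1.
Qed.

End Mean.

(** * Exponential sums *)

Notation normc := ComplexField.Normc.normc.
Section ExponentialSums.
Variable R : realType.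

Definition expsum (I : finType) (c : I -> R[i]) (mu : I -> R) (t : R) : R[i] :=
  \sum_i c i * cexp (- (mu i)%:C * (0 +i* t)).

(** The summand is [Re (c i * conj (c j))]: only the pairs of equal frequencies
    survive when the mean of [|expsum c mu|^2] is taken. *)
Definition gram (I : finType) (c : I -> R[i]) (mu : I -> R) : R :=
  \sum_i \sum_(j | mu i == mu j)
    (complex.Re (c i) * complex.Re (c j) + complex.Im (c i) * complex.Im (c j)).

Lemma sqr_normcE (z : R[i]) : normc z ^+ 2 = complex.Re z ^+ 2 + complex.Im z ^+ 2.
Proof. by case: z => x y /=; rewrite sqr_sqrtr // addr_ge0 ?sqr_ge0. Qed.

Lemma normc_ge0 (z : R[i]) : 0 <= normc z.
Proof. by case: z => x y; apply: sqrtr_ge0. Qed.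

Lemma normcX (z : R[i]) n : normc (z ^+ n) = normc z ^+ n.
Proof.
elim: n => [|n IH]; first by rewrite !expr0 ComplexField.Normc.normc1.
by rewrite !exprS ComplexField.Normc.normcM IH.
Qed.

Lemma Re_sum (I : Type) (r : seq I) (F : I -> R[i]) :
  complex.Re (\sum_(i <- r) F i) = \sum_(i <- r) complex.Re (F i).
Proof. by apply: (big_morph (@complex.Re R)) => [[? ?] [? ?]|]. Qed.

Lemma Im_sum (I : Type) (r : seq I) (F : I -> R[i]) :
  complex.Im (\sum_(i <- r) F i) = \sum_(i <- r) complex.Im (F i).
Proof. by apply: (big_morph (@complex.Im R)) => [[? ?] [? ?]|]. Qed.

Lemma cexp_imag (m t : R) :
  cexp (- m%:C * (0 +i* t)) = cos (m * t) +i* (- sin (m * t)).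
Proof.
rewrite /cexp /= !(mulr0, mul0r, oppr0, subr0, addr0, add0r) expR0 mulNr cosN sinN.
by rewrite mul1r.
Qed.

Lemma cexpD (z w : R[i]) : cexp (z + w) = cexp z * cexp w.
Proof.
case: z w => [x y] [u v]; rewrite /cexp /= expRD cosD sinD.
apply/eqP; rewrite eq_complex /= !(mulr0, mul0r, subr0, addr0, add0r).
by apply/andP; split; apply/eqP; ring.
Qed.

Lemma cexp0 : cexp (0 : R[i]) = 1.
Proof. by rewrite /cexp /= expR0 cos0 sin0 mul1r. Qed.

(** In [|z|^2 = Re z ^ 2 + Im z ^ 2] the cross terms recombine, by the addition
    formulas, into a cosine and a sine of [(mu i - mu j) t], which have mean zero
    unless [mu i = mu j]. *)
Lemma has_mean_sqr_expsum (I : finType) (c : I -> R[i]) (mu : I -> R) :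
  has_mean (fun t => normc (expsum c mu t) ^+ 2) (gram c mu).
Proof.
pose p i j :=
  complex.Re (c i) * complex.Re (c j) + complex.Im (c i) * complex.Im (c j).
pose q i j :=
  complex.Im (c i) * complex.Re (c j) - complex.Re (c i) * complex.Im (c j).
have -> : (fun t => normc (expsum c mu t) ^+ 2) =
  (fun t => \sum_i \sum_j (p i j * cos ((mu i - mu j) * t) +
                            q i j * sin ((mu i - mu j) * t))).
  apply/funext => t; rewrite sqr_normcE Re_sum Im_sum !expr2 !mulr_suml.
  rewrite -big_split /=; apply: eq_bigr => i _.
  rewrite !mulr_sumr -big_split /=; apply: eq_bigr => j _.
  rewrite !cexp_imag mulrBl cosB sinB /p /q.
  by case: (c i) (c j) => [x y] [u v] /=; ring.
apply: has_mean_sum => i.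
rewrite big_mkcond; apply: has_mean_sum => j.
have [e|ne] := eqVneq (mu i) (mu j).
  under eq_fun do rewrite e subrr mul0r cos0 sin0 mulr0 mulr1 addr0.
  exact: has_mean_cst.
have ne' : mu i - mu j != 0 by rewrite subr_eq0.
have := has_meanD (has_meanZ (p i j) (has_mean_cos ne'))
                  (has_meanZ (q i j) (has_mean_sin (mu i - mu j))).
by rewrite !mulr0 addr0.
Qed.

(** The frequencies of the power coincide for many tuples, in particular for the
    rearrangements of a given tuple; these coincidences make up the moments. *)
Lemma expsumX (I : finType) (c : I -> R[i]) (mu : I -> R) k t :
  expsum c mu t ^+ k =
  expsum (fun f : {ffun 'I_k -> I} => \prod_i c (f i)) (fun f => \sum_i mu (f i)) t.
Proof.
rewrite -[in LHS](card_ord k) -prodr_const bigA_distr_bigA /=.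
apply: eq_bigr => f _; rewrite big_split /=; congr (_ * _).
by rewrite -(big_morph _ cexpD cexp0) -mulr_suml sumrN -rmorph_sum.
Qed.

Lemma has_mean_expsumX (I : finType) (c : I -> R[i]) (mu : I -> R) k :
  has_mean (fun t => normc (expsum c mu t) ^+ (2 * k))
   (gram (fun f : {ffun 'I_k -> I} => \prod_i c (f i)) (fun f => \sum_i mu (f i))).
Proof.
under eq_fun do rewrite mulnC exprM -normcX expsumX.
exact: has_mean_sqr_expsum.
Qed.

(** Termwise, [Re (c i * conj (c j)) <= |c i| |c j| <= b i * b j]. *)
Lemma le_gram (I : finType) (c : I -> R[i]) (b : I -> R) (mu : I -> R) :
  (forall i, normc (c i) <= b i) ->
  gram c mu <= gram (fun i => (b i)%:C) mu.
Proof.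
move=> cb; apply: ler_sum => i _; apply: ler_sum => j _ /=.
rewrite mulr0 addr0.
have -> : complex.Re (c i) * complex.Re (c j) +
          complex.Im (c i) * complex.Im (c j)
    = complex.Re (c i * (c j)^*).
  by case: (c i) (c j) => [x y] [u v] /=; ring.
have h : complex.Re (c i * (c j)^*) <= normc (c i * (c j)^*).
  case: (_ * _) => x y /=; apply: le_trans (ler_norm _) _.
  by rewrite -sqrtr_sqr ler_wsqrtr // lerDl sqr_ge0.
apply: le_trans h _; rewrite ComplexField.Normc.normcM.
have -> : normc (c j)^* = normc (c j) by case: (c j) => x y /=; rewrite sqrrN.
by apply: ler_pM; rewrite ?normc_ge0.
Qed.

End ExponentialSums.

(** * Moments of Dirichlet polynomials *)

Section Moment.
Variable R : realType.
Implicit Types (lambda : nat -> R) (A B : {fset nat}) (a : nat -> R[i]).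
Implicit Types (k : nat).

(** The mean of [|D|^(2k)] along the imaginary axis, hence the [2k]-th power of
    the norm of the Dirichlet polynomial [D] in [H_2k], in closed form. *)
Definition moment lambda k A a : R :=
  gram (fun f : {ffun 'I_k -> A} => \prod_i a (val (f i)))
       (fun f => \sum_i lambda (val (f i))).

Lemma dirichlet_polyE lambda A a t :
  dirichlet_poly lambda A a (0 +i* t) =
  expsum (fun n : A => a (val n)) (fun n => lambda (val n)) t.
Proof. by rewrite /dirichlet_poly big_seq_fsetE. Qed.

Lemma has_mean_dirichlet lambda k A a :
  has_mean (fun t => normc (dirichlet_poly lambda A a (0 +i* t)) ^+ (2 * k))
    (moment lambda k A a).
Proof. by under eq_fun do rewrite dirichlet_polyE; exact: has_mean_expsumX. Qed.

(** Continuity of [x `^ p] on the closed half-line.  The nonnegativity of [g] is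
    essential at [l = 0], since [x `^ p = 1] for negative [x]. *)
Lemma cvg_powR (T : Type) (F : set_system T) (FF : Filter F) (g : T -> R) (l p : R) :
  0 < p -> (\forall x \near F, 0 <= g x) -> 0 <= l -> g @ F --> l ->
  g x `^ p @[x --> F] --> l `^ p.
Proof.
move=> p0 g0; rewrite le_eqVlt => /predU1P[<-|l0] gl.
  rewrite powR0 ?gt_eqF //; apply/cvgr0Pnorm_lt => e e0.
  have e'0 : 0 < e `^ p^-1 by apply: powR_gt0.
  have := (@cvgr0Pnorm_lt _ _ _ F _ g).1 gl _ e'0; move=> /(_ FF).
  apply: filterS2 g0 => x gx; rewrite !ger0_norm ?powR_ge0 // => h.
  have -> : e = (e `^ p^-1) `^ p.
    by rewrite -powRrM mulVf ?gt_eqF // powRr1 // ltW.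
  by apply: gt0_ltr_powR => //; rewrite nnegrE ?powR_ge0.
have cp : {for l, continuous (fun y : R => y `^ p)}; last first.
  apply: (@cvg_comp _ _ _ g (fun y => y `^ p) _ _ _ gl). exact: cp.
apply: differentiable_continuous; apply/derivable1_diffP.
by apply: derivable_powR; rewrite in_itv /= l0.
Qed.

Lemma moment_ge0 lambda k A a : 0 <= moment lambda k A a.
Proof.
apply: has_mean_le (has_mean_cst (0 : R)) (has_mean_dirichlet lambda k A a) _ => t.
by rewrite exprn_ge0 ?normc_ge0.
Qed.

Lemma Hnorm_moment lambda k A a : (0 < k)%N ->
  Hnorm (2 * k)%:R (dirichlet_poly lambda A a) =
  moment lambda k A a `^ (2 * k)%:R^-1.
Proof.
move=> k0; apply: cvg_lim => //.
have [_ hm] := has_mean_dirichlet lambda k A a.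
under eq_fun do under eq_Rintegral do rewrite powR_mulrn ?normc_ge0 //.
apply: cvg_powR (moment_ge0 lambda k A a) hm.
  by rewrite invr_gt0 ltr0n muln_gt0.
near=> T; rewrite mulr_ge0 ?invr_ge0 //.
  have T0 : 0 < T by near: T; exact: (nbhs_pinfty_gt (num_real 0)).
  lra.
by apply: Rintegral_ge0 => x _; rewrite exprn_ge0 ?normc_ge0.
Unshelve. all: by end_near. Qed.

(** A convex power lies above its tangent at [s].  Both Jensen's inequality for
    means and the power mean inequality follow by averaging this. *)
Lemma exprn_ge_tangent (y s : R) n : 0 <= y -> 0 <= s ->
  s ^+ n.+1 + n.+1%:R * s ^+ n * (y - s) <= y ^+ n.+1.
Proof.
move=> y0 s0; elim: n => [|n IH]; first by rewrite !expr1 expr0 mulr1 mul1r; lra.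
rewrite (exprS y); apply: le_trans (ler_wpM2l y0 IH).
rewrite -subr_ge0.
have -> : y * (s ^+ n.+1 + n.+1%:R * s ^+ n * (y - s)) -
  (s ^+ n.+2 + n.+2%:R * s ^+ n.+1 * (y - s)) = n.+1%:R * s ^+ n * (y - s) ^+ 2.
  by rewrite !exprS; ring.
by apply: mulr_ge0; [apply: mulr_ge0; rewrite ?exprn_ge0|exact: sqr_ge0].
Qed.

(** Jensen's inequality: the tangent is taken at the mean [s] of [|D|^2], so that
    its linear part averages to zero. *)
Lemma moment1_exp_le lambda k A a : (0 < k)%N ->
  moment lambda 1 A a ^+ k <= moment lambda k A a.
Proof.
case: k => // k _; set s := moment lambda 1 A a.
have h1 : has_mean (fun t => normc (dirichlet_poly lambda A a (0 +i* t)) ^+ 2) s.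
  exact: (has_mean_dirichlet lambda 1 A a).
have := has_meanD (has_mean_cst (s ^+ k.+1))
  (has_meanZ (k.+1%:R * s ^+ k) (has_meanD h1 (has_mean_cst (- s)))).
move/has_mean_le => /(_ _ _ (has_mean_dirichlet lambda k.+1 A a)).
rewrite subrr mulr0 addr0; apply => t /=.
by rewrite exprM exprn_ge_tangent ?moment_ge0 ?exprn_ge0 ?normc_ge0.
Qed.

(** The factor [n] multiplies the [x j] instead of dividing the sum, which avoids
    any division; the tangent is taken at the average of the [n * x j]. *)
Lemma power_mean (n p : nat) (x : 'I_n -> R) : (forall j, 0 <= x j) ->
  n%:R * (\sum_j x j) ^+ p.+1 <= \sum_j (n%:R * x j) ^+ p.+1.
Proof.
move=> x0; set s := \sum_j x j.
have s0 : 0 <= s by apply: sumr_ge0.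
apply: le_trans (ler_sum _ (fun j _ =>
  exprn_ge_tangent p (mulr_ge0 (ler0n _ n) (x0 j)) s0)).
rewrite big_split /= sumr_const card_ord -mulr_sumr sumrB -mulr_sumr.
rewrite sumr_const card_ord -/s.
by rewrite mulr_natl -[s *+ n]mulr_natl subrr mulr0 addr0.
Qed.

End Moment.

(** * Monotonicity and the triangle inequality *)

Section Triangle.
Variable R : realType.
Implicit Types (lambda : nat -> R) (A B : {fset nat}) (a : nat -> R[i]).
Implicit Types (k : nat).

(** This uses that the exponent [2k] is an even integer: it relies on the
    expansion into products of coefficients and on [le_gram]. *)
Lemma le_moment lambda k A a (b : nat -> R) :
  (forall n, n \in A -> normc (a n) <= b n) ->
  moment lambda k A a <= moment lambda k A (fun n => (b n)%:C).
Proof.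
move=> ab; rewrite /moment.
have -> : (fun f : {ffun 'I_k -> A} => \prod_i (b (val (f i)))%:C)
  = (fun f => (\prod_i b (val (f i)))%:C).
  by apply/funext => f; rewrite rmorph_prod.
apply: le_gram => f.
rewrite (big_morph (@normc R) (@ComplexField.Normc.normcM R)
  (@ComplexField.Normc.normc1 R)).
by apply: ler_prod => i _; rewrite normc_ge0 ab // (valP (f i)).
Qed.

Lemma moment_cst lambda k A (w : R) :
  moment lambda k A (fun=> w%:C) = w ^+ (2 * k) * moment lambda k A (fun=> 1).
Proof.
apply: has_mean_unique (has_mean_dirichlet lambda k A _) _.
have := has_meanZ (w ^+ (2 * k)) (has_mean_dirichlet lambda k A (fun=> 1)).
congr has_mean; apply/funext => t.
have -> : dirichlet_poly lambda A (fun=> w%:C) (0 +i* t) =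
    w%:C * dirichlet_poly lambda A (fun=> 1) (0 +i* t).
  by rewrite /dirichlet_poly mulr_sumr; apply: eq_bigr => n _; rewrite mul1r.
rewrite ComplexField.Normc.normcM exprMn; congr (_ * _).
rewrite !(mulnC 2) mulnC !exprM; congr (_ ^+ _).
by rewrite sqr_normcE /= expr0n addr0.
Qed.

(** The triangle inequality in [H_2k] for summands with a common bound: the
    convexity of the power gives it pointwise, and the mean preserves it. *)
Lemma moment_sum lambda k A a n (B : 'I_n -> {fset nat})
    (b : 'I_n -> nat -> R[i]) (Q : R) :
  (0 < k)%N -> (0 < n)%N ->
  (forall t, dirichlet_poly lambda A a (0 +i* t) =
     \sum_j dirichlet_poly lambda (B j) (b j) (0 +i* t)) ->
  (forall j, moment lambda k (B j) (b j) <= Q) ->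
  moment lambda k A a <= n%:R ^+ (2 * k) * Q.
Proof.
move=> k0 n0 aE bQ.
have n0' : 0 < n%:R :> R by rewrite ltr0n.
have -> : (2 * k = (2 * k).-1.+1)%N by rewrite prednK // muln_gt0.
set p := (2 * k).-1.
have hp : (2 * k = p.+1)%N by rewrite prednK // muln_gt0.
rewrite -(ler_pM2l n0').
have h1 := has_meanZ n%:R (has_mean_dirichlet lambda k A a).
have h2 := has_mean_sum (index_enum 'I_n) (fun j =>
  has_meanZ (n%:R ^+ p.+1) (has_mean_dirichlet lambda k (B j) (b j))).
apply: le_trans (has_mean_le h1 h2 _) _ => [t|].
  pose x j := normc (dirichlet_poly lambda (B j) (b j) (0 +i* t)).
  have x0 j : 0 <= x j by exact: normc_ge0.
  apply: (@le_trans _ _ (n%:R * (\sum_j x j) ^+ p.+1)).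
    rewrite ler_pM2l // hp lerXn2r ?nnegrE ?normc_ge0 ?sumr_ge0 //.
    rewrite aE; elim/big_rec2: _ => [|j u v _ h].
      by rewrite ComplexField.Normc.normc0.
    by apply: le_trans (le_normcD _ _) _; rewrite lerD2l.
  apply: le_trans (power_mean p x0) _.
  by apply: ler_sum => j _; rewrite exprMn hp.
rewrite [leRHS]mulrCA -mulr_sumr ler_wpM2l ?exprn_ge0 ?(ltW n0') //.
apply: le_trans (ler_sum _ (fun j _ => bQ j)) _.
by rewrite sumr_const card_ord mulr_natl.
Qed.

Lemma moment1E lambda A a : injective lambda ->
  moment lambda 1 A a = \sum_(n <- A) normc (a n) ^+ 2.
Proof.
move=> inj.
have : has_mean (fun t => normc (dirichlet_poly lambda A a (0 +i* t)) ^+ 2)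
   (gram (fun n : A => a (val n)) (fun n => lambda (val n))).
  by under eq_fun do rewrite dirichlet_polyE; exact: has_mean_sqr_expsum.
move/has_mean_unique => /(_ _ (has_mean_dirichlet lambda 1 A a)) <-.
rewrite big_seq_fsetE; apply: eq_bigr => i _ /=.
rewrite (big_pred1 i) => [|j]; first by rewrite sqr_normcE !expr2.
by rewrite eq_sym (inj_eq inj) (inj_eq val_inj).
Qed.
End Triangle.

(** * Lacunary sets and democracy *)

Section Lacunary.
Variable R : realType.
Implicit Types (lambda : nat -> R) (A B : {fset nat}) (a : nat -> R[i]).
Implicit Types (k : nat).

Definition lacunary lambda k B :=
  forall x y, x \in B -> y \in B -> (x < y)%N -> k%:R * lambda x < lambda y.

(** New indices are added one at a time; since [lambda] is unbounded, the next one
    can be taken beyond [k + 1] times the sum of all the previous frequencies. *)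
Lemma exists_lacunary lambda k n : frequency lambda ->
  exists2 B : {fset nat}, #|` B| = n & lacunary lambda k B.
Proof.
move=> [l0 linc lub]; elim: n => [|n [B cB hB]].
  by exists fset0%fset => // x y; rewrite in_fset0.
pose M := \sum_(x <- B) (k.+1%:R * lambda x).
have [_ [m _ <-] Mm] := (@has_ubPn _ _).1 lub M.
have hM x : x \in B -> k.+1%:R * lambda x < lambda m.
  move=> xB; apply: le_lt_trans Mm; rewrite /M (big_fsetD1 x) //= lerDl.
  by apply: sumr_ge0 => y _; rewrite mulr_ge0.
have hk x : x \in B -> k%:R * lambda x < lambda m.
  move=> xB; apply: le_lt_trans (hM x xB).
  by rewrite ler_wpM2r // ler_nat.
have h1 x : x \in B -> (x < m)%N.
  move=> xB; case: (ltnP x m) => // mx.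
  have : lambda m <= lambda x.
    by move: mx; rewrite leq_eqVlt => /predU1P[->//|/linc/ltW].
  have : lambda x <= k.+1%:R * lambda x by rewrite ler_peMl // ler1n.
  by move=> /le_lt_trans /(_ (hM x xB)) h /(lt_le_trans h); rewrite ltxx.
exists (m |` B)%fset.
  rewrite cardfsU1 cB; case: (boolP (m \in B)) => // /h1; by rewrite ltnn.
move=> x y; rewrite !in_fset1U => /predU1P[->|xB] /predU1P[->|yB].
- by rewrite ltnn.
- by move=> /ltnW; rewrite leqNgt h1.
- by move=> _; exact: hk.
- exact: hB.
Qed.

Lemma seq_max (s : seq nat) : s != [::] ->
  exists2 x, x \in s & forall y, y \in s -> (y <= x)%N.
Proof.
elim: s => // a s IH _; have [->|/IH [x xs hx]] := eqVneq s [::].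
  by exists a; rewrite ?mem_head // => y; rewrite inE => /eqP ->.
case: (leqP a x) => ax.
  by exists x; rewrite ?inE ?xs ?orbT // => y; rewrite inE => /predU1P[->//|/hx].
exists a; rewrite ?mem_head // => y; rewrite inE => /predU1P[->//|/hx yx].
exact: leq_trans yx (ltnW ax).
Qed.

Lemma lacunary_sum_lt lambda k B (s t : seq nat) x y :
  frequency lambda -> lacunary lambda k B ->
  (size s <= k)%N -> x \in B -> y \in B -> (forall z, z \in s -> (z <= x)%N) ->
  y \in t -> (x < y)%N ->
  \sum_(z <- s) lambda z < \sum_(z <- t) lambda z.
Proof.
move=> [l0 linc _] hB sk xB yB mx yt xy.
apply: (@le_lt_trans _ _ (k%:R * lambda x)).
  apply: (@le_trans _ _ (\sum_(z <- s) lambda x)).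
    rewrite !big_seq; apply: ler_sum => z /mx.
    by rewrite leq_eqVlt => /predU1P[->//|/linc/ltW].
  rewrite big_const_seq count_predT iter_addr_0 -[leLHS]mulr_natl.
  by rewrite ler_wpM2r // ler_nat.
apply: lt_le_trans (hB _ _ xB yB xy) _.
by rewrite (big_rem y) //= lerDl sumr_ge0.
Qed.

(** The largest indices of both families agree, because the larger one alone would
    outweigh the whole other sum ([lacunary_sum_lt]); remove them and recurse. *)
Lemma lacunary_perm_eq lambda k B (s t : seq nat) :
  frequency lambda -> lacunary lambda k B ->
  (size s <= k)%N -> size s = size t ->
  {subset s <= B} -> {subset t <= B} ->
  \sum_(z <- s) lambda z = \sum_(z <- t) lambda z -> perm_eq s t.
Proof.
move=> hl hB; move: {2}(size s) (erefl (size s)) => n.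
elim: n s t => [|n IH] s t.
  by move=> /size0nil -> _ /esym /size0nil ->.
move=> sn sk st sB tB E.
have sne : s != [::] by rewrite -size_eq0 sn.
have tne : t != [::] by rewrite -size_eq0 -st sn.
have [x xs mx] := seq_max sne; have [y yt my] := seq_max tne.
case: (ltngtP x y) => [xy|yx|xy].
- have := lacunary_sum_lt hl hB sk (sB _ xs) (tB _ yt) mx yt xy.
  by rewrite E ltxx.
- rewrite st in sk.
  have := lacunary_sum_lt hl hB sk (tB _ yt) (sB _ xs) my xs yx.
  by rewrite E ltxx.
rewrite -xy in yt.
rewrite (permPl (perm_to_rem xs)) perm_sym (permPl (perm_to_rem yt)).
rewrite perm_cons perm_sym.
move: E; rewrite (big_rem x) //= (big_rem x yt) /= => /addrI E.
apply: IH => //; rewrite ?size_rem -?st ?sn //.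
- by rewrite sn in sk; exact: ltnW.
- by move=> z /mem_rem /sB.
- by move=> z /mem_rem /tB.
Qed.

(** By [lacunary_perm_eq] each tuple [f] is paired only with its own
    rearrangements, of which there are at most [k!]. *)
Lemma moment_lacunary lambda k B : frequency lambda -> lacunary lambda k B ->
  moment lambda k B (fun=> 1) <= (k`! * #|` B| ^ k)%:R.
Proof.
move=> hl hB; rewrite /moment /gram.
apply: (@le_trans _ _ (\sum_(f : {ffun 'I_k -> B}) k`!%:R)); last first.
  by rewrite sumr_const card_ffun card_ord -cardfE natrM mulr_natr.
apply: ler_sum => f _.
have -> : \prod_(i < k) (1 : R[i]) = 1 by rewrite big1.
rewrite /= mulr1 mulr0 addr0.
  rewrite sumr_const ler_nat -(card_Sn k).
apply: leq_trans (leq_image_card (fun s : {perm 'I_k} => [ffun i => f (s i)]) _).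
apply: subset_leq_card; apply/fintype.subsetP => g; rewrite unfold_in => /eqP E.
pose v (h : {ffun 'I_k -> B}) := [tuple h i | i < k].
have : perm_eq (v g) (v f).
  apply: (perm_map_inj (@val_inj _ _ B)).
  have sz h : size [seq val x | x <- v h] = k by rewrite size_map size_tuple.
  apply: (lacunary_perm_eq hl hB); rewrite ?sz //.
  - by move=> z /mapP [w _ ->]; exact: valP.
  - by move=> z /mapP [w _ ->]; exact: valP.
  - have vE h : \sum_(z <- [seq val x | x <- v h]) lambda z =
        \sum_i lambda (val (h i)).
      by rewrite big_map big_tuple; apply: eq_bigr => i _; rewrite tnth_mktuple.
    by rewrite !vE.
case/tuple_permP => s vs; apply/fintype.imageP; exists s => //.
apply/ffunP => i; rewrite ffunE.
have := congr1 (fun u : k.-tuple B => tnth u i) (val_inj vs).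
  by rewrite !tnth_mktuple.
Qed.

Lemma powRK (x : R) k : 0 <= x -> (0 < k)%N -> (x `^ k%:R^-1) ^+ k = x.
Proof.
move=> x0 k0; rewrite -powR_mulrn ?powR_ge0 // -powRrM mulVf ?powRr1 //.
by rewrite pnatr_eq0 -lt0n.
Qed.

(** Compare with a lacunary set of cardinality exactly [N]. *)
Lemma democratic_moment lambda k : frequency lambda -> (0 < k)%N ->
  democratic lambda (2 * k)%:R ->
  exists2 K : R, 0 < K & forall A N, (#|` A| <= N)%N ->
    moment lambda k A (fun=> 1) <= K * N%:R ^+ k.
Proof.
move=> hl k0 [C C0 hC]; exists (C ^+ (2 * k) * k`!%:R).
  by rewrite mulr_gt0 ?exprn_gt0 // ltr0n fact_gt0.
move=> A N AN; have [B cB hB] := exists_lacunary k N hl.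
have k20 : (0 < 2 * k)%N by rewrite muln_gt0.
have := hC A B; rewrite cB => /(_ AN); rewrite !Hnorm_moment // => h.
rewrite -(powRK (moment_ge0 lambda k A (fun=> 1)) k20).
apply: (@le_trans _ _ (C ^+ (2 * k) * moment lambda k B (fun=> 1))).
  rewrite -[X in _ * X](powRK (moment_ge0 lambda k B (fun=> 1)) k20) -exprMn.
  by rewrite lerXn2r ?nnegrE ?mulr_ge0 ?powR_ge0 ?(ltW C0).
rewrite -mulrA ler_wpM2l ?exprn_ge0 ?(ltW C0) //.
by have := moment_lacunary hl hB; rewrite cB natrM natrX.
Qed.
End Lacunary.

(** * Decomposition of the coefficients into dyadic levels *)

Section Dyadic.
Variable R : realType.
Implicit Types (lambda : nat -> R) (A B : {fset nat}) (a : nat -> R[i]).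
Implicit Types (k : nat).

(** The last level, [j = m], is the whole of [A]: it takes care of all the
    coefficients that are at most [sigma / 2^m]. *)
Definition level A (c : nat -> R) (sigma : R) m j : {fset nat} :=
  [fset n in A | (j == m) || (sigma / 2 ^+ j.+1 < c n)]%fset.

(** Chebyshev's inequality. *)
Lemma card_level A (c : nat -> R) (sigma : R) m j :
  0 <= sigma -> sigma ^+ 2 = \sum_(n <- A) c n ^+ 2 -> (j < m)%N ->
  (#|` level A c sigma m j| <= 4 ^ j.+1)%N.
Proof.
move=> s0 E jm; set B := level _ _ _ _ _.
have BE n : n \in B = (n \in A) && (sigma / 2 ^+ j.+1 < c n).
  by rewrite !inE (ltn_eqF jm).
have p0 : 0 < 2 ^+ j.+1 :> R by rewrite exprn_gt0.
(* If sigma = 0 all coefficients vanish, and the strict threshold 0 < c n leaves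
   the level empty. *)
have [s1|s1] := eqVneq sigma 0.
  suff -> : B = fset0 by rewrite cardfs0.
  apply/fsetP => n; rewrite BE in_fset0; apply/negbTE; apply/negP => /andP[nA].
  rewrite s1 mul0r => cn.
  move: E; rewrite s1 expr0n /= (big_fsetD1 n) //= => /eqP.
  rewrite eq_sym gt_eqF // ltr_pwDl ?exprn_gt0 //.
  by apply: sumr_ge0 => i _; exact: sqr_ge0.
have s2 : 0 < sigma ^+ 2 by rewrite exprn_gt0 // lt_def s1.
rewrite -(ler_nat R) -(ler_pM2r s2) [(4 ^ _)%:R]natrX.
have -> : 4%:R ^+ j.+1 = 2 ^+ j.+1 ^+ 2 :> R by rewrite exprAC; congr (_ ^+ _); ring.
rewrite -ler_pdivrMl ?exprn_gt0 // mulrCA [_^-1 * _]mulrC -expr_div_n.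
rewrite E; apply: (@le_trans _ _ (\sum_(n <- B) c n ^+ 2)).
  rewrite card_fset_sum1 natr_sum mulr_suml !big_seq; apply: ler_sum => n.
  rewrite BE mul1r => /andP[_ /ltW cn].
  have w0 : 0 <= sigma / 2 ^+ j.+1 by rewrite divr_ge0 // ltW.
  by rewrite lerXn2r ?nnegrE ?(le_trans w0 cn).
rewrite [leRHS](big_fsetID _ (fun n => (j == m) || (sigma / 2 ^+ j.+1 < c n))) /=.
by rewrite lerDl; apply: sumr_ge0 => n _; exact: sqr_ge0.
Qed.

(** A single level suffices: at the first [j] such that [n] is in level [j], either
    [j = 0] or [c n] fails the threshold [sigma / 2^j] of level [j - 1]. *)
Lemma level_dominates A (c : nat -> R) (sigma : R) m n :
  n \in A -> 0 <= c n <= sigma ->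
  c n <= \sum_(j < m.+1) sigma / 2 ^+ j * (n \in level A c sigma m j)%:R.
Proof.
move=> nA /andP[c0 cs].
have s0 : 0 <= sigma := le_trans c0 cs.
have exP : exists j, (j == m) || (sigma / 2 ^+ j.+1 < c n) by exists m; rewrite eqxx.
case: (ex_minnP exP) => j Pj minj.
have jm : (j < m.+1)%N by rewrite ltnS minj ?eqxx.
rewrite (bigD1 (Ordinal jm)) //= !inE nA Pj /= mulr1.
apply: (@le_trans _ _ (sigma / 2 ^+ j)); last first.
  by rewrite lerDl; apply: sumr_ge0 => i _; rewrite mulr_ge0 ?divr_ge0 ?exprn_ge0.
case: j {Pj} minj jm => [|j] minj jm; first by rewrite expr0 divr1.
rewrite leNgt; apply/negP => h.
by have := minj j; rewrite h orbT ltnn => /(_ isT).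
Qed.

Lemma dirichlet_poly_levels lambda A m (w : 'I_m -> R) (B : 'I_m -> {fset nat}) s :
  (forall j, (B j `<=` A)%fset) ->
  dirichlet_poly lambda A (fun n => (\sum_j w j * (n \in B j)%:R)%:C) s =
  \sum_j dirichlet_poly lambda (B j) (fun=> (w j)%:C) s.
Proof.
move=> BA; rewrite /dirichlet_poly.
under eq_bigr do rewrite rmorph_sum mulr_suml.
rewrite exchange_big /=; apply: eq_bigr => j _.
rewrite -(big_fset_incl _ (BA j)) => [|n nA /negbTE nB]; last first.
  by rewrite nB mulr0 mul0r.
by rewrite !big_seq; apply: eq_bigr => n ->; rewrite mulr1.
Qed.

(** Each of the [m + 1] levels contributes at most [(2 sigma)^(2k) K], as its height
    [sigma / 2^j] is compensated by its size [4^(j+1)]. *)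
Lemma moment_le_levels lambda k A a m (K : R) :
  injective lambda -> (0 < k)%N -> 0 < K ->
  (forall B N, (#|` B| <= N)%N ->
     moment lambda k B (fun=> 1) <= K * N%:R ^+ k) ->
  (#|` A| <= 4 ^ m)%N ->
  moment lambda k A a <=
  (m.+1%:R * (2 * Num.sqrt (moment lambda 1 A a))) ^+ (2 * k) * K.
Proof.
move=> inj k0 K0 hK Am; set sigma := Num.sqrt _.
have s0 : 0 <= sigma by exact: sqrtr_ge0.
have E : sigma ^+ 2 = \sum_(n <- A) normc (a n) ^+ 2.
  by rewrite sqr_sqrtr ?moment_ge0 // moment1E.
pose c n := normc (a n).
pose w (j : 'I_m.+1) := sigma / 2 ^+ j.
pose B (j : 'I_m.+1) := level A c sigma m j.
have cs n : n \in A -> 0 <= c n <= sigma.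
  move=> nA; rewrite normc_ge0 /=.
  rewrite -(@ler_pXn2r _ 2) ?nnegrE ?normc_ge0 // E (big_fsetD1 n) //= lerDl.
  by apply: sumr_ge0 => i _; exact: sqr_ge0.
have cB j : (#|` B j| <= 4 ^ j.+1)%N.
  have := ltn_ord j; rewrite ltnS leq_eqVlt => /predU1P[jm|jm]; last first.
    exact: (card_level s0 E jm).
  apply: leq_trans (_ : #|` A| <= _)%N; first exact: fsubset_leq_card (fset_sub _ _).
  by apply: leq_trans Am _; rewrite jm leq_exp2l.
apply: (@le_trans _ _ (moment lambda k A
    (fun n => (\sum_j w j * (n \in B j)%:R)%:C))).
  by apply: le_moment => n nA; exact: level_dominates nA (cs n nA).
rewrite exprMn -mulrA.
apply: (@moment_sum _ _ _ _ _ _ B (fun j => fun=> (w j)%:C)) => //.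
  move=> t; apply: dirichlet_poly_levels => j.
  exact: fset_sub.
move=> j; rewrite moment_cst.
apply: le_trans (ler_wpM2l _ (hK _ _ (cB j))) _.
  by rewrite exprn_ge0 // divr_ge0 ?exprn_ge0.
rewrite mulrCA mulrC ler_wpM2r ?(ltW K0) //.
rewrite exprM (exprM (2 * sigma)) -exprMn.
have -> : w j ^+ 2 * (4 ^ j.+1)%:R = (2 * sigma) ^+ 2; last by [].
have four : 4%:R = 2 ^+ 2 :> R by rewrite -natrX.
have p0 : 2 ^+ j != 0 :> R by rewrite expf_neq0 ?pnatr_eq0.
by rewrite /w natrX four exprAC [2 ^+ j.+1]exprS; field.
Qed.

End Dyadic.

Theorem proposition4p2 (R : realType) (lambda : nat -> R) (k : nat)
    (hlambda : frequency lambda) (hk : (0 < k)%N)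
    (hdem : democratic lambda (2 * k)%:R) :
  (forall (A : {fset nat}) (a : nat -> R[i]),
      Hnorm 2 (dirichlet_poly lambda A a)
        <= Hnorm (2 * k)%:R (dirichlet_poly lambda A a)) /\
  (exists2 C : R, 0 < C &
    forall (A : {fset nat}) (a : nat -> R[i]),
      Hnorm (2 * k)%:R (dirichlet_poly lambda A a)
        <= C * ln (#|` A|.+1)%:R * Hnorm 2 (dirichlet_poly lambda A a)).
Proof.
have k20 : (0 < 2 * k)%N by rewrite muln_gt0.
have inj : injective lambda.
  case: hlambda => _ linc _ m n E.
  by case: (ltngtP m n) => // /linc; rewrite E ltxx.
have H2 A a :
    Hnorm 2 (dirichlet_poly lambda A a) = Num.sqrt (moment lambda 1 A a).
  have := Hnorm_moment lambda A a (ltn0Sn 0).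
  by rewrite muln1 powR12_sqrt ?moment_ge0.
have Hk A a : Hnorm (2 * k)%:R (dirichlet_poly lambda A a) ^+ (2 * k) =
    moment lambda k A a.
  by rewrite Hnorm_moment // powRK ?moment_ge0.
have Hk0 A a : 0 <= Hnorm (2 * k)%:R (dirichlet_poly lambda A a).
  by rewrite Hnorm_moment // powR_ge0.
split=> [A a|].
  rewrite H2 -(ler_pXn2r k20) ?nnegrE ?sqrtr_ge0 // Hk exprM.
  rewrite sqr_sqrtr ?moment_ge0 //.
  exact: moment1_exp_le.
have [K K0 hK] := democratic_moment hlambda hk hdem.
(* With l = trunc_log 2 |A| the levels give l + 2 <= 3 ln (|A| + 1) / ln 2 terms
   of size 2 times the norm in H_2, whence the constant 6 / ln 2. *)
have ln20 : 0 < ln (2 : R) by rewrite ln_gt0 // ltr1n.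
pose L := K `^ (2 * k)%:R^-1.
have L0 : 0 < L by rewrite powR_gt0.
exists (6 / ln 2 * L) => [|A a]; first by rewrite mulr_gt0 // divr_gt0.
have bound m : (#|` A| <= 4 ^ m)%N ->
    Hnorm (2 * k)%:R (dirichlet_poly lambda A a)
      <= m.+1%:R * (2 * Hnorm 2 (dirichlet_poly lambda A a)) * L.
  move=> Am; have h : 0 <= m.+1%:R * (2 * Hnorm 2 (dirichlet_poly lambda A a)) * L.
    by rewrite H2 !mulr_ge0 ?sqrtr_ge0 // ltW.
  rewrite -(ler_pXn2r k20) ?nnegrE // Hk exprMn powRK ?(ltW K0) // H2.
  exact: moment_le_levels.
(* For empty A the logarithm vanishes, but so do both norms. *)
have [A0|A0] := posnP #|` A|.
  have := bound 0%N; rewrite A0 => /(_ isT) /le_trans; apply.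
  rewrite ln1 mulr0 mul0r H2 moment1E // (cardfs0_eq A0) big_seq_fset0 sqrtr0.
  by rewrite !mulr0 mul0r.
have /andP[lo hi] := trunc_log_bounds (isT : (1 < 2)%N) A0.
set l := trunc_log 2 _ in lo hi.
have Al : (#|` A| <= 4 ^ l.+1)%N.
  by apply: leq_trans (ltnW hi) _; rewrite leq_exp2r.
apply: le_trans (bound _ Al) _.
set H := Hnorm 2 _.
have H0 : 0 <= H by rewrite /H H2 sqrtr_ge0.
set x := ln #|` A|.+1%:R.
have h1 : ln 2 <= x by rewrite ler_ln ?posrE ?ltr0n // ler_nat ltnS.
have h2 : l%:R * ln 2 <= x.
  rewrite mulr_natl -lnXn // ler_ln ?posrE ?exprn_gt0 ?ltr0n // -natrX ler_nat.
  exact: leq_trans lo (leqnSn _).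
have h3 : l.+2%:R <= 3 / ln 2 * x.
  rewrite mulrAC ler_pdivlMr // -[l.+2]addn2 natrD mulrDl; lra.
have -> : 6 / ln 2 * L * x * H = 3 / ln 2 * x * (2 * H) * L by field; rewrite gt_eqF.
by rewrite ler_wpM2r ?(ltW L0) // ler_wpM2r // mulr_ge0.
Qed.
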